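(* Let $\lambda\in\mathbb{C}$, $\alpha\in\mathbb{C}\setminus\{-1,-2,-3,\dots\}$, $\beta>-1$, $\rho\in\{z\in\mathbb{C}:|z|<1\}$, $x>0$. Then $$M\!\left(\lambda,\alpha+1,\frac{x\rho}{\rho-1}\right)=(1-\rho)^\lambda\sum_{k=0}^\infty\frac{(\lambda)_k}{(\alpha+1)_k}\;{}_2F_1\!\left(\begin{array}{c}\lambda+k,\ \alpha-\beta\\ \alpha+1+k\end{array};\rho\right)\rho^kL_k^\beta(x).$$
   Context: Complex powers are principal. $(z)_n:=\prod_{i=1}^n(z+i-1)$ is the Pochhammer symbol. $M(a,b,z):=\sum_{n=0}^\infty\frac{(a)_n}{(b)_n}\frac{z^n}{n!}$ is Kummer's confluent hypergeometric function and ${}_2F_1(a,b;c;z):=\sum_{n=0}^\infty\frac{(a)_n(b)_n}{(c)_n}\frac{z^n}{n!}$ is the Gauss hypergeometric function. The Laguerre polynomials are $L_n^\beta(z):=\frac{(\beta+1)_n}{n!}M(-n,\beta+1,z)$, $n\in\mathbb{N}_0=\{0,1,2,\dots\}$. *)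

(* Defs.v *)
(* Stdlib world: Stdlib's R, Coquelicot's complex numbers C and series. *)
From Stdlib Require Import Reals Factorial Lra.
From Coquelicot Require Import Coquelicot.

Open Scope R_scope.

Definition Cexp (z : C) : C :=
  (exp (Re z) * cos (Im z), exp (Re z) * sin (Im z)).

(* Principal argument, with values in (-PI, PI]; it has no meaning at 0. *)
Definition Carg (z : C) : R :=
  if Rle_dec 0 (Im z) then acos (Re z / Cmod z) else - acos (Re z / Cmod z).

Definition Clog (z : C) : C := (ln (Cmod z), Carg z).

(* Principal power z^w, meaningful for z <> 0 only; Coquelicot's Cpow (the
   notation ^ on C) has natural-number exponents. *)
Definition Cpower (z w : C) : C := Cexp (w * Clog z)%C.

(* Sum of a complex series, total as Coquelicot's Series is: it is the limit of
   the partial sums when they converge (CSeries_unique). *)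
Definition CSeries (a : nat -> C) : C :=
  (Series (fun n => Re (a n)), Series (fun n => Im (a n))).

Fixpoint Cpoch (z : C) (n : nat) : C :=
  match n with
  | O => RtoC 1
  | S m => (Cpoch z m * (z + INR m))%C
  end.

Definition KummerM (a b z : C) : C :=
  CSeries (fun n => Cpoch a n / Cpoch b n * (z ^ n / INR (fact n)))%C.

Definition Hyp2F1 (a b c z : C) : C :=
  CSeries (fun n => Cpoch a n * Cpoch b n / Cpoch c n * (z ^ n / INR (fact n)))%C.

Definition Laguerre (n : nat) (beta z : C) : C :=
  (Cpoch (beta + 1) n / INR (fact n) * KummerM (- INR n) (beta + 1) z)%C.

Lemma sum_n_Re_Im (a : nat -> C) (n : nat) :
  sum_n (G := C_AbelianMonoid) a n =
  (sum_n (fun k => Re (a k)) n, sum_n (fun k => Im (a k)) n).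
Proof.
induction n as [|n IH].
- rewrite !sum_O. now destruct (a O).
- rewrite !sum_Sn, IH. reflexivity.
Qed.

Lemma CSeries_unique (a : nat -> C) (l : C) :
  is_series (V := C_NormedModule) a l -> CSeries a = l.
Proof.
intros H.
assert (H' : filterlim (sum_n (G := C_AbelianMonoid) a) eventually
               (locally (T := prod_UniformSpace R_UniformSpace R_UniformSpace) l)) by exact H.
unfold CSeries. destruct l as [x y]. f_equal; apply is_series_unique.
- intros P [e He].
  destruct (H' (fun z => P (fst z))) as [N HN].
  { exists e. intros z [Hz _]. now apply He. }
  exists N. intros n Hn. specialize (HN n Hn). now rewrite sum_n_Re_Im in HN.
- intros P [e He].
  destruct (H' (fun z => P (snd z))) as [N HN].
  { exists e. intros z [_ Hz]. now apply He. }
  exists N. intros n Hn. specialize (HN n Hn). now rewrite sum_n_Re_Im in HN.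
Qed.

Lemma Carg_bounds (z : C) : z <> RtoC 0 -> - PI < Carg z <= PI.
Proof.
intros Hz. apply Cmod_gt_0 in Hz as Hm.
unfold Carg. pose proof (acos_bound (Re z / Cmod z)) as Hb. pose proof PI_RGT_0.
destruct (Rle_dec 0 (Im z)) as [Hi|Hi]; [lra|].
split; [|lra].
assert (Hlt : -1 < Re z / Cmod z).
{ apply Rmult_lt_reg_r with (Cmod z); [exact Hm|].
  unfold Rdiv. rewrite Rmult_assoc, Rinv_l, Rmult_1_r by lra.
  pose proof (Cmod2_alt z). nra. }
assert (Hle : Re z / Cmod z <= 1).
{ apply Rmult_le_reg_r with (Cmod z); [exact Hm|].
  unfold Rdiv. rewrite Rmult_assoc, Rinv_l, Rmult_1_r by lra.
  pose proof (Cmod2_alt z). nra. }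
destruct (Req_dec (acos (Re z / Cmod z)) PI) as [E|E]; [|lra].
exfalso. assert (Hc : cos (acos (Re z / Cmod z)) = -1) by now rewrite E, cos_PI.
rewrite cos_acos in Hc by lra. lra.
Qed.

Lemma Cexp_Clog (z : C) : z <> RtoC 0 -> Cexp (Clog z) = z.
Proof.
intros Hz. apply Cmod_gt_0 in Hz as Hm.
pose proof (Cmod2_alt z) as H2.
set (m := Cmod z) in *. set (t := Re z / m).
assert (Ht : m * t = Re z) by (unfold t; field; lra).
assert (Hb : -1 <= t <= 1).
{ pose proof (re_le_Cmod z) as Hr. apply Rabs_le_between in Hr. fold m in Hr.
  split; apply Rmult_le_reg_l with m; lra. }
assert (Hs : m * sqrt (1 - t²) = Rabs (Im z)).
{ rewrite <- (sqrt_Rsqr m) at 1 by lra.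
  rewrite <- sqrt_mult by (unfold Rsqr; nra).
  rewrite <- sqrt_Rsqr_abs. f_equal. unfold Rsqr. nra. }
unfold Cexp, Clog, Carg. cbn [Re Im fst snd]. fold m. fold t.
rewrite exp_ln by exact Hm.
rewrite (surjective_pairing z) at 3. f_equal.
- destruct (Rle_dec 0 (Im z)); rewrite ?cos_neg, cos_acos by lra; exact Ht.
- destruct (Rle_dec 0 (Im z)) as [Hi|Hi].
  + rewrite sin_acos, Hs by lra. apply Rabs_pos_eq, Hi.
  + rewrite sin_neg, sin_acos by lra.
    rewrite Rabs_left in Hs by lra. change (snd z) with (Im z). lra.
Qed.

(* Main.v *)
Require Import Defs.
From Stdlib Require Import Reals Lra Lia Factorial.
From Coquelicot Require Import Coquelicot.
Open Scope R_scope.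

(** Expand everything in powers of [x] and [rho].  With [k = m + j], where [m] is
    the power of [x] taken from the Laguerre polynomial of degree [k], and with [i]
    the summation index of the Gauss function, the right-hand side without the
    factor [(1 - rho)^lambda] is the triple series of the terms

      [(-x)^m / m! * rho^(m+j+i) * (lambda)_(m+j+i) / (alpha+1)_(m+j+i)
       * (beta+1+m)_j / j! * (alpha-beta)_i / i!].

    Sum it in the other order: first over [j + i = n] for fixed [m], then over [n],
    then over [m].  The first sum is a Chu-Vandermonde convolution
    ([poch_fact_vandermonde]) equal to [(alpha+1+m)_n / n!]; it cancels part of the
    denominator, so that the second sum is the binomial series
    [(1 - rho)^(-lambda-m)] ([binomial_series]).  What remains is
    [(1 - rho)^(-lambda)] times the Kummer series at [x rho / (rho - 1)].

    The exchange of summations rests on absolute convergence.  Although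
    [(beta+1+m)_j / j!] depends on [m] and [j] jointly, it is at most
    [(1-q)^(-N-m) q^(-j)] for every [q] in [(0, 1)] and every natural
    [N >= |beta+1|] ([poch_fact_geom_bound]).  Since [(lambda)_n / (alpha+1)_n] grows more slowly
    than any [t^n] with [t > 1], the triple series is dominated by a product
    [K * Y^m / m! * q^j * q^i] ([expansion_term_bound]).  For series dominated by a
    product, both orders of summation agree with the sum along the simplices
    [m + j + i = p] ([triple_series_regroup]).  The binomial series is summed by
    means of the differential equation that it satisfies on the segment from [0]
    to [rho]. *)

(** * Sums and series of complex numbers *)

Notation Cis_series := (is_series (V := C_NormedModule)).

(** A named constant with codomain [C], so that [ring] and [field] see complex
    numbers and not elements of the carrier of an abstract monoid. *)
Definition Csum (a : nat -> C) (n : nat) : C := sum_n (G := C_AbelianMonoid) a n.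

Lemma Csum_O (a : nat -> C) : Csum a 0 = a 0%nat.
Proof. apply (sum_O (G := C_AbelianMonoid)). Qed.

Lemma Csum_S (a : nat -> C) (n : nat) : Csum a (S n) = (Csum a n + a (S n))%C.
Proof. apply (sum_Sn (G := C_AbelianMonoid)). Qed.

Lemma Csum_ext (a b : nat -> C) (n : nat) :
  (forall k, (k <= n)%nat -> a k = b k) -> Csum a n = Csum b n.
Proof. apply (sum_n_ext_loc (G := C_AbelianMonoid)). Qed.

Lemma Csum_plus (a b : nat -> C) (n : nat) :
  Csum (fun k => a k + b k)%C n = (Csum a n + Csum b n)%C.
Proof. apply (sum_n_plus (G := C_AbelianMonoid)). Qed.

Lemma Csum_scal (c : C) (a : nat -> C) (n : nat) :
  Csum (fun k => c * a k)%C n = (c * Csum a n)%C.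
Proof. apply (sum_n_mult_l (K := C_Ring)). Qed.

Lemma Csum_minus (a b : nat -> C) (n : nat) :
  Csum (fun k => a k - b k)%C n = (Csum a n - Csum b n)%C.
Proof.
induction n as [|n IH].
- now rewrite !Csum_O.
- rewrite !Csum_S, IH. ring.
Qed.

Lemma Csum_S_l (a : nat -> C) (n : nat) :
  Csum a (S n) = (a 0%nat + Csum (fun k => a (S k)) n)%C.
Proof.
induction n as [|n IH].
- now rewrite Csum_S, !Csum_O.
- rewrite Csum_S, IH, (Csum_S (fun k => a (S k))). ring.
Qed.

Lemma Csum_rev (a : nat -> C) (n : nat) :
  Csum (fun k => a (n - k)%nat) n = Csum a n.
Proof.
revert a. induction n as [|n IH]; intros a.
- reflexivity.
- rewrite Csum_S_l, (Csum_S a), <- (IH a).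
  replace (S n - 0)%nat with (S n) by lia.
  rewrite (Csum_ext (fun k => a (S n - S k)%nat) (fun k => a (n - k)%nat))
    by (intros k _; f_equal; lia).
  ring.
Qed.

(** Both sides sum [b] over the triangle [k + i <= N], along its antidiagonals on
    the left and along its rows on the right. *)
Lemma Csum_triangle (b : nat -> nat -> C) (N : nat) :
  Csum (fun n => Csum (fun k => b k (n - k)%nat) n) N =
  Csum (fun k => Csum (b k) (N - k)) N.
Proof.
induction N as [|N IH].
- reflexivity.
- rewrite !Csum_S, IH, Nat.sub_diag, Csum_O.
  rewrite (Csum_ext (fun k => Csum (b k) (S N - k))
    (fun k => Csum (b k) (N - k) + b k (S N - k)%nat)%C).
  + rewrite Csum_plus. ring.
  + intros k Hk. rewrite Nat.sub_succ_l by exact Hk. apply Csum_S.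
Qed.

Lemma Cmod_Csum (a : nat -> C) (n : nat) :
  Cmod (Csum a n) <= sum_n (fun k => Cmod (a k)) n.
Proof.
induction n as [|n IH].
- rewrite Csum_O, sum_O. lra.
- rewrite Csum_S, sum_Sn. change plus with Rplus.
  eapply Rle_trans; [apply Cmod_triangle|]. lra.
Qed.

Lemma Rsum_le (a b : nat -> R) (n : nat) :
  (forall k, (k <= n)%nat -> a k <= b k) -> sum_n a n <= sum_n b n.
Proof.
intros H. induction n as [|n IH].
- rewrite !sum_O. apply H; lia.
- rewrite !sum_Sn. apply Rplus_le_compat; [|apply H; lia].
  apply IH. intros k Hk. apply H. lia.
Qed.

Lemma Cis_series_eps (a : nat -> C) (l : C) :
  Cis_series a l <->
  (forall eps : posreal, exists N, forall n, (N <= n)%nat -> Cmod (Csum a n - l) < eps).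
Proof.
split; intros H.
- intros eps.
  pose proof (proj1 (filterlim_locally_ball_norm (U:=C_NormedModule) _ _) H eps) as H1.
  destruct H1 as [N HN]. exists N. intros n Hn. specialize (HN n Hn).
  exact HN.
- apply (proj2 (filterlim_locally_ball_norm (U:=C_NormedModule) _ _)). intros eps.
  destruct (H eps) as [N HN]. exists N. intros n Hn. apply HN, Hn.
Qed.

Lemma Cis_series_error (a : nat -> C) (l : C) (e : nat -> R) :
  (forall n, Cmod (Csum a n - l) <= e n) -> is_lim_seq e 0 -> Cis_series a l.
Proof.
intros H He. apply Cis_series_eps. intros eps.
apply is_lim_seq_spec in He. destruct (He eps) as [N HN].
exists N. intros n Hn. specialize (HN n Hn). specialize (H n).
rewrite Rminus_0_r in HN. apply Rabs_def2 in HN. lra.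
Qed.

Lemma Cis_series_ext (a b : nat -> C) (l : C) :
  (forall n, a n = b n) -> Cis_series a l -> Cis_series b l.
Proof. apply (is_series_ext (V := C_NormedModule)). Qed.

Lemma Cis_series_scal (c : C) (a : nat -> C) (l : C) :
  Cis_series a l -> Cis_series (fun n => c * a n)%C (c * l)%C.
Proof. intros H. apply (is_series_scal (V := C_NormedModule) c a l H). Qed.

Lemma Cis_series_plus (a b : nat -> C) (la lb : C) :
  Cis_series a la -> Cis_series b lb -> Cis_series (fun n => a n + b n)%C (la + lb)%C.
Proof. intros Ha Hb. apply (is_series_plus (V := C_NormedModule) a b la lb Ha Hb). Qed.

Lemma Cis_series_inj (a : nat -> C) (l l' : C) :
  Cis_series a l -> Cis_series a l' -> l = l'.
Proof.
intros H H'. now rewrite <- (CSeries_unique a l H), <- (CSeries_unique a l' H').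
Qed.

Lemma Cis_series_dominated (a : nat -> C) (g : nat -> R) :
  (forall n, Cmod (a n) <= g n) -> ex_series g -> Cis_series a (CSeries a).
Proof.
intros H Hg.
destruct (ex_series_le (V := C_CompleteNormedModule) a g) as [l Hl].
- intros n. apply H.
- exact Hg.
- assert (Hl' : Cis_series a l) by exact Hl.
  now rewrite (CSeries_unique a l Hl').
Qed.

Lemma Cis_series_finite (a : nat -> C) (N : nat) :
  (forall n, (N < n)%nat -> a n = RtoC 0) -> Cis_series a (Csum a N).
Proof.
intros H. apply Cis_series_eps. intros eps. exists N. intros n Hn.
replace (Csum a n) with (Csum a N).
- replace (Csum a N - Csum a N)%C with (RtoC 0) by ring. rewrite Cmod_0. apply eps.
- induction Hn as [|n Hn IH]; [reflexivity|].
  rewrite Csum_S, <- IH, H by lia. ring.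
Qed.

Lemma is_lim_seq_sum (g : nat -> R) (G : R) : is_series g G -> is_lim_seq (sum_n g) G.
Proof. intros H. exact H. Qed.

Lemma Cis_series_tail (a : nat -> C) (l : C) (g : nat -> R) (G : R) (n : nat) :
  Cis_series a l -> is_series g G -> (forall k, Cmod (a k) <= g k) ->
  Cmod (l - Csum a n) <= G - sum_n g n.
Proof.
intros Ha Hg H.
assert (Hp : forall p, Cmod (Csum a (n + p) - Csum a n) <= sum_n g (n + p) - sum_n g n).
{ intros p. induction p as [|p IH].
  - rewrite Nat.add_0_r. replace (Csum a n - Csum a n)%C with (RtoC 0) by ring.
    rewrite Cmod_0. lra.
  - rewrite Nat.add_succ_r, Csum_S, sum_Sn. change plus with Rplus.
    replace (Csum a (n + p) + a (S (n + p)) - Csum a n)%C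
      with ((Csum a (n + p) - Csum a n) + a (S (n + p)))%C by ring.
    eapply Rle_trans; [apply Cmod_triangle|]. specialize (H (S (n + p))). lra. }
apply Rnot_lt_le. intros Hlt.
set (d := Cmod (l - Csum a n) - (G - sum_n g n)).
assert (Hd : 0 < d / 2) by (unfold d; lra).
destruct (proj1 (Cis_series_eps a l) Ha (mkposreal _ Hd)) as [N1 H1].
apply is_lim_seq_sum, is_lim_seq_spec in Hg. destruct (Hg (mkposreal _ Hd)) as [N2 H2].
set (p := (N1 + N2)%nat).
specialize (H1 (n + p)%nat ltac:(unfold p; lia)). specialize (H2 (n + p)%nat ltac:(unfold p; lia)).
cbn [pos] in H1, H2. apply Rabs_def2 in H2. specialize (Hp p).
assert (Cmod (l - Csum a n) <= Cmod (Csum a (n + p) - Csum a n) + Cmod (Csum a (n + p) - l)).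
{ rewrite <- (Cmod_opp (Csum a (n + p) - l)).
  replace (l - Csum a n)%C
    with ((Csum a (n + p) - Csum a n) + - (Csum a (n + p) - l))%C by ring.
  apply Cmod_triangle. }
unfold d in *. lra.
Qed.

Lemma Cmod_series_le (a : nat -> C) (l : C) (g : nat -> R) (G : R) :
  Cis_series a l -> is_series g G -> (forall k, Cmod (a k) <= g k) ->
  Cmod l <= G.
Proof.
intros Ha Hg H. pose proof (Cis_series_tail a l g G 0 Ha Hg H) as T.
rewrite Csum_O, sum_O in T. specialize (H 0%nat).
replace l with ((l - a 0%nat) + a 0%nat)%C by ring.
eapply Rle_trans; [apply Cmod_triangle|]. lra.
Qed.

(** * Regrouping multiple series *)

Lemma ex_series_cauchy_prod (a b : nat -> R) :
  (forall n, 0 <= a n) -> (forall n, 0 <= b n) -> ex_series a -> ex_series b ->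
  ex_series (fun n => sum_n (fun k => a k * b (n - k)%nat) n).
Proof.
intros Ha Hb [la Hla] [lb Hlb]. exists (la * lb).
eapply is_series_ext; [|apply (is_series_mult_pos a b la lb Hla Hlb Ha Hb)].
intros n. symmetry. apply sum_n_Reals.
Qed.

Lemma Rsum_minus (a b : nat -> R) (n : nat) :
  sum_n (fun k => a k - b k) n = sum_n a n - sum_n b n :> R.
Proof.
induction n as [|n IH].
- now rewrite !sum_O.
- rewrite !sum_Sn, IH. change plus with Rplus. ring.
Qed.

Lemma Rsum_triangle (b : nat -> nat -> R) (N : nat) :
  sum_n (fun n => sum_n (fun k => b k (n - k)%nat) n) N =
  sum_n (fun k => sum_n (b k) (N - k)) N.
Proof.
induction N as [|N IH].
- now rewrite !sum_O.
- rewrite !sum_Sn, IH, Nat.sub_diag, sum_O.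
  rewrite (sum_n_ext_loc (fun k => sum_n (b k) (S N - k))
    (fun k => plus (sum_n (b k) (N - k)) (b k (S N - k)%nat))).
  + rewrite sum_n_plus. now rewrite plus_assoc.
  + intros k Hk. rewrite Nat.sub_succ_l by exact Hk. apply sum_Sn.
Qed.

(** The sum of the rows up to [N], minus the triangular sum of index [N], consists
    of the row tails [i > N - k] for [k <= N].  Its modulus is at most the
    corresponding quantity for the majorant [B k * D i], which tends to [0] because
    the Cauchy product of two convergent nonnegative series converges to the
    product of their sums. *)
Lemma series_diagonal (b : nat -> nat -> C) (B D : nat -> R) :
  ex_series B -> ex_series D ->
  (forall k, 0 <= B k) -> (forall i, 0 <= D i) ->
  (forall k i, Cmod (b k i) <= B k * D i) ->
  exists S : C,
    Cis_series (fun k => CSeries (b k)) S /\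
    Cis_series (fun n => Csum (fun k => b k (n - k)%nat) n) S.
Proof.
intros [SB HB] [SD HD] HB0 HD0 Hb.
assert (Hrow : forall k, is_series (fun i => B k * D i) (B k * SD)).
{ intros k. apply (is_series_scal (V := R_NormedModule) (B k) D SD HD). }
assert (Hin : forall k, Cis_series (b k) (CSeries (b k))).
{ intros k. apply (Cis_series_dominated _ (fun i => B k * D i)).
  - apply Hb.
  - eexists. apply Hrow. }
assert (Hout : Cis_series (fun k => CSeries (b k)) (CSeries (fun k => CSeries (b k)))).
{ apply (Cis_series_dominated _ (fun k => SD * B k)).
  - intros k. rewrite Rmult_comm.
    apply (Cmod_series_le (b k) _ (fun i => B k * D i)).
    + apply Hin.
    + apply Hrow.
    + apply Hb.
  - exists (SD * SB). apply (is_series_scal (V := R_NormedModule) SD B SB HB). }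
set (S := CSeries (fun k => CSeries (b k))) in *.
exists S. split; [exact Hout|].
(* [e] bounds the tails of the rows of index at most [N]; [f] bounds the sum of
   the rows of index larger than [N]. *)
set (e := fun N => sum_n (fun k => B k * SD) N
          - sum_n (fun n => sum_n (fun k => B k * D (n - k)%nat) n) N).
set (f := fun N => SD * SB - sum_n (fun k => SD * B k) N).
apply (Cis_series_error _ _ (fun N => e N + f N)).
- intros N.
  replace (Csum (fun n => Csum (fun k => b k (n - k)%nat) n) N - S)%C with
    (- Csum (fun k => CSeries (b k) - Csum (b k) (N - k))%C N
     + - (S - Csum (fun k => CSeries (b k)) N))%C
    by (rewrite Csum_triangle, Csum_minus; ring).
  eapply Rle_trans; [apply Cmod_triangle|]. rewrite !Cmod_opp.
  apply Rplus_le_compat.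
  + eapply Rle_trans; [apply Cmod_Csum|].
    unfold e. rewrite (Rsum_triangle (fun k i => B k * D i)).
    apply Rle_trans with
      (sum_n (fun k => B k * SD - sum_n (fun i => B k * D i) (N - k)) N).
    * apply Rsum_le. intros k _.
      apply (Cis_series_tail (b k) _ (fun i => B k * D i)); [apply Hin|apply Hrow|apply Hb].
    * right. apply Rsum_minus.
  + apply (Cis_series_tail (fun k => CSeries (b k)) S (fun k => SD * B k)).
    * exact Hout.
    * apply (is_series_scal (V := R_NormedModule) SD B SB HB).
    * intros k. rewrite Rmult_comm.
      apply (Cmod_series_le (b k) _ (fun i => B k * D i)); [apply Hin|apply Hrow|apply Hb].
- replace (Finite 0) with (Finite ((SB * SD - SB * SD) + (SD * SB - SD * SB))) by (f_equal; ring).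
  apply is_lim_seq_plus'; apply is_lim_seq_minus'.
  + apply is_lim_seq_sum.
    eapply is_series_ext; [|rewrite Rmult_comm; apply (is_series_scal (V := R_NormedModule) SD B SB HB)].
    intros n. apply Rmult_comm.
  + apply is_lim_seq_sum. eapply is_series_ext;
     [|apply (is_series_mult_pos B D SB SD HB HD HB0 HD0)].
    intros n. symmetry. apply sum_n_Reals.
  + apply is_lim_seq_const.
  + apply is_lim_seq_sum. apply (is_series_scal (V := R_NormedModule) SD B SB HB).
Qed.

(** Both sides sum [g] over the simplex of triples with sum [p], grouped by the
    last index on the left and by the first one on the right. *)
Lemma Csum_simplex (g : nat -> nat -> nat -> C) (p : nat) :
  Csum (fun k => Csum (fun m => g m (k - m)%nat (p - k)%nat) k) p =
  Csum (fun m => Csum (fun i => g m (p - m - i)%nat i) (p - m)) p.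
Proof.
rewrite (Csum_ext _ (fun k => Csum (fun m => g m (k - m)%nat (p - m - (k - m))%nat) k)).
2:{ intros k Hk. apply Csum_ext. intros m Hm. f_equal. lia. }
rewrite (Csum_triangle (fun m j => g m j (p - m - j)%nat)).
apply Csum_ext. intros m Hm.
rewrite <- (Csum_rev (fun i => g m (p - m - i)%nat i)).
apply Csum_ext. intros i Hi. f_equal. lia.
Qed.

Lemma Rsum_nonneg (a : nat -> R) (n : nat) : (forall k, 0 <= a k) -> 0 <= sum_n a n.
Proof.
intros H. induction n as [|n IH].
- rewrite sum_O. apply H.
- rewrite sum_Sn. change plus with Rplus. specialize (H (S n)). lra.
Qed.

(** By [series_diagonal], either grouping has the same sum as the series of the
    partial sums over the simplices [m + j + i = p], which are the same for both
    groupings by [Csum_simplex]. *)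
Lemma triple_series_regroup (g : nat -> nat -> nat -> C) (U V W : nat -> R) :
  (forall n, 0 <= U n) -> (forall n, 0 <= V n) -> (forall n, 0 <= W n) ->
  ex_series U -> ex_series V -> ex_series W ->
  (forall m j i, Cmod (g m j i) <= U m * V j * W i) ->
  exists S : C,
    Cis_series (fun k => CSeries (fun i => Csum (fun m => g m (k - m)%nat i) k)) S /\
    Cis_series (fun m => CSeries (fun n => Csum (fun i => g m (n - i)%nat i) n)) S.
Proof.
intros U0 V0 W0 HU HV HW Hg.
destruct (series_diagonal (fun k i => Csum (fun m => g m (k - m)%nat i) k)
  (fun k => sum_n (fun m => U m * V (k - m)%nat) k) W) as [S1 [H1 D1]].
- now apply ex_series_cauchy_prod.
- exact HW.
- intros k. apply Rsum_nonneg. intros m. now apply Rmult_le_pos.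
- exact W0.
- intros k i. eapply Rle_trans; [apply Cmod_Csum|].
  eapply Rle_trans; [|right; apply (sum_n_mult_r (K := R_Ring) (W i))].
  apply Rsum_le. intros m _. apply Hg.
- destruct (series_diagonal (fun m n => Csum (fun i => g m (n - i)%nat i) n)
    U (fun n => sum_n (fun i => W i * V (n - i)%nat) n)) as [S2 [H2 D2]].
  + exact HU.
  + now apply ex_series_cauchy_prod.
  + exact U0.
  + intros n. apply Rsum_nonneg. intros i. now apply Rmult_le_pos.
  + intros m n. eapply Rle_trans; [apply Cmod_Csum|].
    eapply Rle_trans; [|right; apply (sum_n_mult_l (K := R_Ring) (U m))].
    apply Rsum_le. intros i _. eapply Rle_trans; [apply Hg|].
    right. unfold mult. simpl. ring.
  + exists S1. split; [exact H1|].
    replace S1 with S2; [exact H2|].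
    apply (Cis_series_inj _ _ _ D2).
    apply (Cis_series_ext _ _ _ (fun p => Csum_simplex g p) D1).
Qed.

(** * Pochhammer symbols *)

(** The coefficient of [z ^ n] in [(1 - z) ^ (- a)] ([binomial_series]). *)
Definition poch_fact (a : C) (n : nat) : C := (Cpoch a n / INR (fact n))%C.

Lemma RtoC_neq_0 (r : R) : r <> 0 -> RtoC r <> RtoC 0.
Proof. intros H E. apply H. now apply RtoC_inj. Qed.

Lemma INR_S_C (n : nat) : RtoC (INR (S n)) = (RtoC (INR n) + 1)%C.
Proof. now rewrite S_INR, RtoC_plus. Qed.

Lemma INR_S_neq_0_C (n : nat) : RtoC (INR (S n)) <> RtoC 0.
Proof. apply RtoC_neq_0. now apply not_0_INR. Qed.

Lemma INR_fact_neq_0_C (n : nat) : RtoC (INR (fact n)) <> RtoC 0.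
Proof. apply RtoC_neq_0, INR_fact_neq_0. Qed.

Lemma INR_fact_S_C (n : nat) :
  RtoC (INR (fact (S n))) = ((RtoC (INR n) + 1) * RtoC (INR (fact n)))%C.
Proof. now rewrite <- INR_S_C, <- RtoC_mult, <- mult_INR. Qed.

Lemma poch_fact_O (a : C) : poch_fact a 0 = RtoC 1.
Proof. unfold poch_fact. simpl. field. Qed.

Lemma poch_fact_S (a : C) (n : nat) :
  (RtoC (INR (S n)) * poch_fact a (S n))%C = ((a + INR n) * poch_fact a n)%C.
Proof.
unfold poch_fact. rewrite INR_fact_S_C, INR_S_C. cbn [Cpoch].
field. split; [apply INR_fact_neq_0_C|]. rewrite <- INR_S_C. apply INR_S_neq_0_C.
Qed.

(** Write [w n] for the left-hand side.  Splitting the factor [n + 1] of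
    [(n + 1) * w (n + 1)] as [i + (n + 1 - i)] and applying [poch_fact_S] to the
    first or the second factor of each term gives [(a + b + n) * w n], which is
    the recurrence satisfied by the right-hand side. *)
Lemma poch_fact_vandermonde (a b : C) (n : nat) :
  Csum (fun i => poch_fact a i * poch_fact b (n - i))%C n = poch_fact (a + b) n.
Proof.
induction n as [|n IH].
- rewrite Csum_O. simpl. rewrite !poch_fact_O. ring.
- assert (E : (RtoC (INR (S n)) * Csum (fun i => poch_fact a i * poch_fact b (S n - i)) (S n))%C
            = (RtoC (INR (S n)) * poch_fact (a + b) (S n))%C).
  { rewrite poch_fact_S, <- IH, <- Csum_scal.
    rewrite (Csum_ext _ (fun i => (RtoC (INR i) * poch_fact a i) * poch_fact b (S n - i)
             + poch_fact a i * (RtoC (INR (S n - i)) * poch_fact b (S n - i)))%C).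
    2:{ intros i Hi. rewrite (minus_INR _ _ Hi), RtoC_minus. ring. }
    rewrite Csum_plus, Csum_S_l, Csum_S, Nat.sub_diag. simpl (INR 0).
    rewrite (Csum_ext (fun k => RtoC (INR (S k)) * poch_fact a (S k) * poch_fact b (S n - S k))%C
      (fun k => (a + INR k) * (poch_fact a k * poch_fact b (n - k)))%C).
    2:{ intros k Hk. rewrite poch_fact_S, Nat.sub_succ. ring. }
    rewrite (Csum_ext
      (fun k => poch_fact a k * (RtoC (INR (S n - k)) * poch_fact b (S n - k)))%C
      (fun k => (b + INR n - INR k) * (poch_fact a k * poch_fact b (n - k)))%C).
    2:{ intros k Hk. rewrite Nat.sub_succ_l, poch_fact_S by exact Hk.
        rewrite (minus_INR _ _ Hk), RtoC_minus. ring. }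
    rewrite <- Csum_scal.
    rewrite (Csum_ext (fun k => (a + b + INR n) * (poch_fact a k * poch_fact b (n - k)))%C
      (fun k => (a + INR k) * (poch_fact a k * poch_fact b (n - k))
         + (b + INR n - INR k) * (poch_fact a k * poch_fact b (n - k)))%C)
      by (intros k _; ring).
    rewrite Csum_plus. ring. }
  pose proof (INR_S_neq_0_C n) as Hn.
  apply (f_equal (fun z => / RtoC (INR (S n)) * z)%C) in E.
  rewrite !Cmult_assoc, !Cinv_l, !Cmult_1_l in E by exact Hn. exact E.
Qed.

Lemma Cpoch_add (a : C) (n m : nat) :
  Cpoch a (n + m) = (Cpoch a n * Cpoch (a + INR n) m)%C.
Proof.
induction m as [|m IH].
- rewrite Nat.add_0_r. simpl. ring.
- rewrite Nat.add_succ_r. simpl. rewrite IH, plus_INR, RtoC_plus. ring.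
Qed.

Lemma Cpoch_neq_0 (a : C) (n : nat) :
  (forall k, (a + INR k)%C <> RtoC 0) -> Cpoch a n <> RtoC 0.
Proof.
intros H. induction n as [|n IH].
- apply RtoC_neq_0. lra.
- simpl. now apply Cmult_neq_0.
Qed.

(** The binomial coefficient [(r + j - 1 choose j)], the value of [poch_fact] at a
    real argument; for [r >= 0] it majorizes [poch_fact] on the disc of radius [r]
    ([Cmod_poch_fact]). *)
Fixpoint multichoose (r : R) (j : nat) : R :=
  match j with
  | O => 1
  | S j' => multichoose r j' * (r + INR j') / INR (S j')
  end.

(** Both sides are [r (r + 1) ... (r + j) / j!]; this relates the columns [r] and
    [r + 1] of the table and yields Pascal's rule. *)
Lemma multichoose_succ (r : R) (j : nat) :
  multichoose r (S j) * INR (S j) = r * multichoose (r + 1) j.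
Proof.
induction j as [|j IH].
- simpl. field.
- cbn [multichoose] in *. pose proof (pos_INR j). rewrite !S_INR in *.
  apply (f_equal (fun z => z * (r + 1 + INR j) / (INR j + 1))) in IH.
  transitivity (multichoose r j * (r + INR j) / (INR j + 1) * (INR j + 1) *
     (r + 1 + INR j) / (INR j + 1)); [field; lra|].
  rewrite IH. field. lra.
Qed.

Lemma multichoose_pascal (r : R) (j : nat) :
  multichoose (r + 1) (S j) = multichoose r (S j) + multichoose (r + 1) j.
Proof.
pose proof (multichoose_succ r j) as H. pose proof (pos_INR j).
apply Rmult_eq_reg_r with (INR (S j)); [|rewrite S_INR; lra].
rewrite Rmult_plus_distr_r, H. cbn [multichoose]. rewrite S_INR. field. lra.
Qed.

(** [(1 - s)^(-N)] is the sum over [j] of the left-hand sides.  Bounding a single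
    term needs no summation: Pascal's rule and
    [(1 - s)^(-N) + s (1 - s)^(-N-1) = (1 - s)^(-N-1)] allow a double induction. *)
Lemma multichoose_geom_bound (s : R) (N j : nat) :
  0 <= s < 1 -> multichoose (INR N) j * s ^ j <= (/ (1 - s)) ^ N.
Proof.
intros Hs. revert j.
assert (Hi : 1 <= / (1 - s)).
{ rewrite <- Rinv_1. apply Rinv_le_contravar; lra. }
induction N as [|N IHN]; intros j.
- destruct j as [|j]; [simpl; lra|].
  pose proof (multichoose_succ 0 j) as H. rewrite Rmult_0_l in H.
  pose proof (pos_INR j).
  apply Rmult_integral in H as [H|H]; [|rewrite S_INR in H; lra].
  change (INR 0) with 0. rewrite H. simpl. lra.
- induction j as [|j IHj].
  + simpl multichoose. rewrite pow_O, Rmult_1_l. now apply pow_R1_Rle.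
  + rewrite S_INR, multichoose_pascal, <- S_INR.
    rewrite Rmult_plus_distr_r. specialize (IHN (S j)).
    replace ((/ (1 - s)) ^ S N) with ((/ (1 - s)) ^ N + s * (/ (1 - s)) ^ S N)
      by (simpl; field; lra).
    apply Rplus_le_compat; [exact IHN|].
    replace (multichoose (INR (S N)) j * s ^ S j)
      with (s * (multichoose (INR (S N)) j * s ^ j)) by (simpl; ring).
    apply Rmult_le_compat_l; lra.
Qed.

Lemma Cmod_INR (n : nat) : Cmod (RtoC (INR n)) = INR n.
Proof. rewrite Cmod_R. apply Rabs_pos_eq, pos_INR. Qed.

Lemma Cmod_poch_fact (a : C) (r : R) (j : nat) :
  Cmod a <= r -> Cmod (poch_fact a j) <= multichoose r j.
Proof.
intros Ha. pose proof (Cmod_ge_0 a) as H0.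
induction j as [|j IH].
- rewrite poch_fact_O, Cmod_1. simpl. lra.
- pose proof (pos_INR j) as Hj.
  apply Rmult_le_reg_l with (INR (S j)); [rewrite S_INR; lra|].
  rewrite <- (Cmod_INR (S j)) at 1. rewrite <- Cmod_mult, poch_fact_S, Cmod_mult.
  cbn [multichoose].
  replace (INR (S j) * (multichoose r j * (r + INR j) / INR (S j)))
    with ((r + INR j) * multichoose r j) by (rewrite S_INR; field; lra).
  apply Rmult_le_compat; try apply Cmod_ge_0; [|exact IH].
  eapply Rle_trans; [apply Cmod_triangle|]. rewrite Cmod_INR. lra.
Qed.

Lemma poch_fact_geom_bound (a : C) (N j : nat) (s : R) :
  0 <= s < 1 -> Cmod a <= INR N ->
  Cmod (poch_fact a j) * s ^ j <= (/ (1 - s)) ^ N.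
Proof.
intros Hs Ha. eapply Rle_trans; [|apply (multichoose_geom_bound s N j Hs)].
apply Rmult_le_compat_r; [apply pow_le; lra|]. now apply Cmod_poch_fact.
Qed.

(** The initial segment, where the ratio is not controlled, is absorbed by the
    constant: the sum of its values bounds each of them, and [t >= 1]. *)
Lemma geometric_growth (w : nat -> R) (t : R) (n0 : nat) :
  1 <= t -> (forall n, 0 <= w n) ->
  (forall n, (n0 <= n)%nat -> w (S n) <= t * w n) ->
  forall n, w n <= sum_n w n0 * t ^ n.
Proof.
intros Ht Hw H.
assert (Hle : forall n m, (m <= n)%nat -> w m <= sum_n w n).
{ intros n. induction n as [|n IH]; intros m Hm.
  - replace m with 0%nat by lia. rewrite sum_O. lra.
  - rewrite sum_Sn. change plus with Rplus.
    assert (0 <= sum_n w n) by (eapply Rle_trans; [apply (Hw 0%nat)|apply IH; lia]).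
    destruct (Nat.eq_dec m (S n)) as [->|Hne].
    + lra.
    + specialize (IH m ltac:(lia)). specialize (Hw (S n)). lra. }
assert (H0 : 0 <= sum_n w n0) by (eapply Rle_trans; [apply (Hw 0%nat)|apply Hle; lia]).
intros n. induction n as [|n IH].
- rewrite pow_O, Rmult_1_r. apply Hle. lia.
- destruct (Nat.le_gt_cases n0 n) as [Hn|Hn].
  + specialize (H n Hn). simpl. nra.
  + specialize (Hle n0 (S n) ltac:(lia)). pose proof (pow_R1_Rle t (S n) Ht). nra.
Qed.

(** Consecutive quotients are multiplied by [(a + n) / (b + n)], which tends to
    [1] and hence is eventually at most [t] in modulus. *)
Lemma Cpoch_ratio_bound (a b : C) (t : R) :
  1 < t -> (forall k, (b + INR k)%C <> RtoC 0) ->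
  exists K, 0 <= K /\ forall n, Cmod (Cpoch a n / Cpoch b n) <= K * t ^ n.
Proof.
intros Ht Hb.
destruct (INR_unbounded ((Cmod a + t * Cmod b) / (t - 1))) as [n0 Hn0].
exists (sum_n (fun n => Cmod (Cpoch a n / Cpoch b n)%C) n0).
assert (G : forall n, Cmod (Cpoch a n / Cpoch b n) <=
   sum_n (fun n => Cmod (Cpoch a n / Cpoch b n)%C) n0 * t ^ n).
{ apply geometric_growth.
  - lra.
  - intros n. apply Cmod_ge_0.
  - intros n Hn. apply le_INR in Hn.
    pose proof (Cpoch_neq_0 b n Hb) as Hp.
    assert (E : (Cpoch a (S n) / Cpoch b (S n))%C =
      ((a + INR n) / (b + INR n) * (Cpoch a n / Cpoch b n))%C).
    { cbn [Cpoch]. field. split; [exact Hp|apply Hb]. }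
    rewrite E, Cmod_mult. apply Rmult_le_compat_r; [apply Cmod_ge_0|].
    rewrite Cmod_div by apply Hb.
    pose proof (proj1 (Cmod_gt_0 _) (Hb n)) as Hpos.
    apply Rmult_le_reg_r with (Cmod (b + INR n)); [exact Hpos|].
    unfold Rdiv. rewrite Rmult_assoc, Rinv_l, Rmult_1_r by lra.
    pose proof (Cmod_triangle a (INR n)) as T1.
    pose proof (Cmod_triangle (b + INR n) (- b)) as T2.
    replace (b + INR n + - b)%C with (RtoC (INR n)) in T2 by ring.
    rewrite Cmod_opp, Cmod_INR in T2. rewrite Cmod_INR in T1.
    assert (Cmod a + t * Cmod b <= (t - 1) * INR n).
    { apply (Rmult_lt_compat_l (t - 1)) in Hn0; [|lra].
      replace ((t - 1) * ((Cmod a + t * Cmod b) / (t - 1))) with (Cmod a + t * Cmod b) in Hn0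
        by (field; lra).
      assert ((t - 1) * INR n0 <= (t - 1) * INR n) by (apply Rmult_le_compat_l; lra).
      lra. }
    nra. }
split; [|exact G].
specialize (G 0%nat). rewrite pow_O, Rmult_1_r in G.
eapply Rle_trans; [apply Cmod_ge_0|exact G].
Qed.

(** The decay of [r ^ n] pays for three things at once: the growth [t ^ n] of a
    quotient of Pochhammer symbols, one factor [q ^ n] spent on bounding
    [poch_fact] by [poch_fact_geom_bound], and one factor [q ^ n] left over for
    summability. *)
Lemma geometric_room (r : R) : 0 <= r < 1 ->
  exists t q, 1 < t /\ 0 < q < 1 /\ r * t <= q * q.
Proof.
intros Hr.
(* With [t := 2 / (1 + r)] the product [r * t] is less than [1]; [q] is the mean
   of [1] and [r * t], whose square is at least [r * t]. *)
exists (2 / (1 + r)), ((1 + 3 * r) / (2 * (1 + r))).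
assert (E : forall a b, 0 < b -> a / b * b = a) by (intros; field; lra).
repeat split.
- apply Rmult_lt_reg_r with (1 + r); [lra|]. rewrite E; lra.
- apply Rdiv_lt_0_compat; lra.
- apply Rmult_lt_reg_r with (2 * (1 + r)); [lra|]. rewrite E; lra.
- apply Rmult_le_reg_r with ((2 * (1 + r)) * (2 * (1 + r))); [nra|].
  replace (r * (2 / (1 + r)) * (2 * (1 + r) * (2 * (1 + r)))) with (8 * r * (1 + r))
    by (field; lra).
  replace ((1 + 3 * r) / (2 * (1 + r)) * ((1 + 3 * r) / (2 * (1 + r))) *
     (2 * (1 + r) * (2 * (1 + r)))) with ((1 + 3 * r) * (1 + 3 * r)) by (field; lra).
  nra.
Qed.

Lemma Cpoch_ratio_power_bound (a c z : C) :
  Cmod z < 1 -> (forall n, (c + INR n)%C <> RtoC 0) ->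
  exists K q, 0 <= K /\ 0 < q < 1 /\
    forall n, Cmod (z ^ n * (Cpoch a n / Cpoch c n)) <= K * (q * q) ^ n.
Proof.
intros Hz Hc. pose proof (Cmod_ge_0 z) as Hz0.
destruct (geometric_room (Cmod z)) as [t [q [Ht [Hq Htq]]]]; [lra|].
destruct (Cpoch_ratio_bound a c t Ht Hc) as [K [HK Hb]].
exists K, q. split; [exact HK|]. split; [exact Hq|]. intros n.
rewrite Cmod_mult, Cmod_pow.
apply Rle_trans with (Cmod z ^ n * (K * t ^ n)).
- apply Rmult_le_compat_l; [now apply pow_le|apply Hb].
- replace (Cmod z ^ n * (K * t ^ n)) with (K * (Cmod z * t) ^ n)
    by (rewrite Rpow_mult_distr; ring).
  apply Rmult_le_compat_l; [exact HK|]. apply pow_incr. split; [nra|exact Htq].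
Qed.

(** * The binomial series *)

Lemma Cexp_plus (z w : C) : Cexp (z + w) = (Cexp z * Cexp w)%C.
Proof.
destruct z as [a b], w as [c d]. unfold Cexp, Cplus, Cmult. cbn [Re Im fst snd].
rewrite exp_plus, cos_plus, sin_plus. f_equal; ring.
Qed.

Lemma Cexp_0 : Cexp 0 = RtoC 1.
Proof.
unfold Cexp, RtoC. cbn [Re Im fst snd]. rewrite exp_0, cos_0, sin_0. f_equal; ring.
Qed.

Lemma Cpower_plus_INR (z w : C) (n : nat) :
  z <> RtoC 0 -> Cpower z (w + INR n) = (Cpower z w * z ^ n)%C.
Proof.
intros Hz. induction n as [|n IH].
- simpl. rewrite Cplus_0_r. ring.
- rewrite INR_S_C, Cpow_S.
  replace (Cpower z (w + (INR n + 1))) with (Cpower z (w + INR n) * Cexp (Clog z))%C.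
  + rewrite IH, Cexp_Clog by exact Hz. ring.
  + unfold Cpower. rewrite <- Cexp_plus. f_equal. ring.
Qed.

(** The principal logarithm on the right half-plane, in a form that can be
    differentiated: the arccosine in [Carg] is not differentiable on the positive
    real axis. *)
Definition Clog_right (z : C) : C :=
  (ln (Re z * Re z + Im z * Im z) / 2, atan (Im z / Re z)).

Lemma Clog_Clog_right (z : C) : 0 < Re z -> Clog z = Clog_right z.
Proof.
intros Hx. pose proof (Cmod2_alt z) as H2.
assert (Hm : 0 < Cmod z).
{ apply Cmod_gt_0. intros ->. simpl in Hx. lra. }
unfold Clog, Clog_right. f_equal.
- replace (Re z * Re z + Im z * Im z) with (Cmod z * Cmod z) by (simpl in H2; lra).
  rewrite ln_mult by exact Hm. lra.
- assert (Hq : 0 < Re z / Cmod z) by (apply Rdiv_lt_0_compat; assumption).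
  assert (Hs : sqrt (1 - (Re z / Cmod z)²) = Rabs (Im z) / Cmod z).
  { rewrite <- (Rabs_pos_eq (Cmod z)) at 2 by lra.
    rewrite <- Rabs_div by lra. rewrite <- sqrt_Rsqr_abs. f_equal.
    unfold Rsqr. apply Rmult_eq_reg_r with (Cmod z ^ 2); [|nra].
    replace ((1 - Re z / Cmod z * (Re z / Cmod z)) * Cmod z ^ 2)
      with (Cmod z ^ 2 - Re z ^ 2) by (field; lra).
    replace (Im z / Cmod z * (Im z / Cmod z) * Cmod z ^ 2) with (Im z ^ 2) by (field; lra).
    lra. }
  assert (Hat : acos (Re z / Cmod z) = atan (Rabs (Im z) / Re z)).
  { rewrite acos_atan, Hs by exact Hq. f_equal. field. lra. }
  unfold Carg. destruct (Rle_dec 0 (Im z)) as [Hi|Hi]; rewrite Hat.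
  + now rewrite Rabs_pos_eq.
  + rewrite Rabs_left by lra. rewrite <- atan_opp. f_equal. field. lra.
Qed.

Definition is_Cderive (f : R -> C) (t : R) (l : C) : Prop :=
  is_derive (fun s => Re (f s)) t (Re l) /\ is_derive (fun s => Im (f s)) t (Im l).

Lemma is_Cderive_mult (f g : R -> C) (t : R) (f' g' : C) :
  is_Cderive f t f' -> is_Cderive g t g' ->
  is_Cderive (fun s => f s * g s)%C t (f' * g t + f t * g')%C.
Proof.
intros [F1 F2] [G1 G2]. split.
- evar_last.
  { apply (is_derive_minus (V := R_NormedModule) (fun s => Re (f s) * Re (g s))
      (fun s => Im (f s) * Im (g s)));
    [apply (Derive.is_derive_mult _ _ _ _ _ F1 G1)|apply (Derive.is_derive_mult _ _ _ _ _ F2 G2)]. }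
  unfold minus, plus, opp. simpl. unfold Re, Im. ring.
- evar_last.
  { apply (is_derive_plus (V := R_NormedModule) (fun s => Re (f s) * Im (g s))
      (fun s => Im (f s) * Re (g s)));
    [apply (Derive.is_derive_mult _ _ _ _ _ F1 G2)|apply (Derive.is_derive_mult _ _ _ _ _ F2 G1)]. }
  unfold plus. simpl. unfold Re, Im. ring.
Qed.

Lemma is_Cderive_const (c : C) (t : R) : is_Cderive (fun _ => c) t 0.
Proof. split; apply (is_derive_const (V := R_NormedModule)). Qed.

Lemma is_Cderive_exp (f : R -> C) (t : R) (f' : C) :
  is_Cderive f t f' -> is_Cderive (fun s => Cexp (f s)) t (f' * Cexp (f t))%C.
Proof.
intros [F1 F2].
pose proof (is_derive_comp (V := R_NormedModule) exp _ _ _ _ (is_derive_exp _) F1) as He.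
pose proof (is_derive_comp (V := R_NormedModule) cos _ _ _ _ (is_derive_cos _) F2) as Hc.
pose proof (is_derive_comp (V := R_NormedModule) sin _ _ _ _ (is_derive_sin _) F2) as Hs.
split.
- evar_last; [apply (Derive.is_derive_mult _ _ _ _ _ He Hc)|].
  unfold scal. simpl. unfold mult. simpl. unfold Re, Im. ring.
- evar_last; [apply (Derive.is_derive_mult _ _ _ _ _ He Hs)|].
  unfold scal. simpl. unfold mult. simpl. unfold Re, Im. ring.
Qed.

Lemma is_Cderive_0_const (f : R -> C) (a b : R) :
  (forall t, a <= t <= b -> is_Cderive f t 0) -> a < b -> f a = f b.
Proof.
intros H Hab. rewrite (surjective_pairing (f a)), (surjective_pairing (f b)). f_equal.
- apply (eq_is_derive (V := R_NormedModule) (fun s => fst (f s))); [|exact Hab].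
  intros t Ht. apply (H t Ht).
- apply (eq_is_derive (V := R_NormedModule) (fun s => snd (f s))); [|exact Hab].
  intros t Ht. apply (H t Ht).
Qed.

Lemma Re_1_minus_pos (z : C) : Cmod z < 1 -> 0 < Re (1 - z).
Proof.
intros H. pose proof (re_le_Cmod z) as R1. apply Rabs_le_between in R1.
unfold Cminus, Cplus, Copp, RtoC, Re in *. simpl in *. lra.
Qed.

Lemma is_Cderive_Clog_right (rho : C) (t : R) :
  0 < Re (1 - t * rho) ->
  is_Cderive (fun s => Clog_right (1 - s * rho)) t (- rho / (1 - t * rho))%C.
Proof.
destruct rho as [a b]. intros H.
assert (H' : 0 < 1 - t * a) by (unfold Cminus, Cplus, Copp, Cmult, RtoC, Re in H; simpl in H; lra).
assert (Hn : 0 < (1 - t * a) * (1 - t * a) + t * b * (t * b)) by nra.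
split.
- apply (is_derive_ext (fun s => ln ((1 - s * a) * (1 - s * a) + (s * b) * (s * b)) / 2)).
  { intros s. unfold Clog_right, Cminus, Cplus, Copp, Cmult, RtoC, Re, Im. simpl.
    f_equal. f_equal. ring. }
  auto_derive; [nra|].
  unfold Cdiv, Cinv, Cminus, Cplus, Copp, Cmult, RtoC, Re, Im. simpl. field.
  repeat split; nra.
- apply (is_derive_ext (fun s => atan (- (s * b) / (1 - s * a)))).
  { intros s. unfold Clog_right, Cminus, Cplus, Copp, Cmult, RtoC, Re, Im. simpl.
    f_equal. f_equal; ring. }
  auto_derive; [lra|].
  unfold Cdiv, Cinv, Cminus, Cplus, Copp, Cmult, RtoC, Re, Im. simpl. field.
  repeat split; nra.
Qed.

Lemma Cis_series_pair (a : nat -> C) (x y : R) :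
  is_series (fun n => Re (a n)) x -> is_series (fun n => Im (a n)) y ->
  Cis_series a (x, y).
Proof.
intros Hx Hy.
apply (Cis_series_error _ _ (fun n => Rabs (sum_n (fun k => Re (a k)) n - x)
   + Rabs (sum_n (fun k => Im (a k)) n - y))).
- intros n. unfold Csum. rewrite sum_n_Re_Im.
  set (u := sum_n _ n). set (v := sum_n _ n).
  replace ((u, v) - (x, y))%C with (RtoC (u - x) + Ci * RtoC (v - y))%C.
  + eapply Rle_trans; [apply Cmod_triangle|].
    rewrite Cmod_mult, Cmod_Ci, !Cmod_R. lra.
  + unfold Cminus, Cplus, Copp, Cmult, Ci, RtoC. simpl. f_equal; ring.
- replace (Finite 0) with (Finite (Rabs (x - x) + Rabs (y - y)))
    by (f_equal; rewrite !Rminus_diag, Rabs_R0; ring).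
  apply is_lim_seq_plus'.
  + apply (is_lim_seq_abs _ (Finite (x - x))), is_lim_seq_minus';
      [apply is_lim_seq_sum, Hx|apply is_lim_seq_const].
  + apply (is_lim_seq_abs _ (Finite (y - y))), is_lim_seq_minus';
      [apply is_lim_seq_sum, Hy|apply is_lim_seq_const].
Qed.

Lemma Cis_series_shift (a : nat -> C) (l : C) :
  a 0%nat = RtoC 0 -> Cis_series (fun n => a (S n)) l -> Cis_series a l.
Proof.
intros H0 H. apply (is_series_decr_1 (V := C_NormedModule) a l).
rewrite H0. change (plus l (opp (RtoC 0 : C_NormedModule))) with (l + - RtoC 0)%C.
now replace (l + - RtoC 0)%C with l by ring.
Qed.

(** The sum of the [f n * t ^ n] at real [t], built from two real power series so
    that their theorem on termwise differentiation applies. *)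
Definition Cpseries (f : nat -> C) (t : R) : C :=
  (PSeries (fun n => Re (f n)) t, PSeries (fun n => Im (f n)) t).

Lemma Rabs_lt_CV_radius (a : nat -> R) (r M t : R) :
  (forall n, Rabs (a n * r ^ n) <= M) -> Rabs t < r ->
  Rbar_lt (Rabs t) (CV_radius a).
Proof.
intros H Ht. eapply Rbar_lt_le_trans with (Finite r); [exact Ht|].
apply (proj1 (CV_radius_bounded a)). now exists M.
Qed.

Lemma Re_mult_R (z : C) (t : R) : Re (z * RtoC t) = Re z * t.
Proof. destruct z. unfold Cmult, RtoC, Re. simpl. ring. Qed.

Lemma Im_mult_R (z : C) (t : R) : Im (z * RtoC t) = Im z * t.
Proof. destruct z. unfold Cmult, RtoC, Im. simpl. ring. Qed.

Lemma im_le_Cmod (z : C) : Rabs (Im z) <= Cmod z.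
Proof. eapply Rle_trans; [apply Rmax_r|apply Rmax_Cmod]. Qed.

Lemma CV_radius_component (p : C -> R) (f : nat -> C) (r M t : R) :
  (forall z, Rabs (p z) <= Cmod z) ->
  (forall n, Cmod (f n) * r ^ n <= M) -> Rabs t < r ->
  Rbar_lt (Rabs t) (CV_radius (fun n => p (f n))).
Proof.
intros Hp Hf Ht.
assert (Hr : 0 <= r) by (pose proof (Rabs_pos t); lra).
apply (Rabs_lt_CV_radius _ r M); [|exact Ht]. intros n.
rewrite Rabs_mult, (Rabs_pos_eq (r ^ n)) by now apply pow_le.
eapply Rle_trans; [|apply (Hf n)]. apply Rmult_le_compat_r; [now apply pow_le|].
apply Hp.
Qed.

Lemma Cpseries_sum (f : nat -> C) (r M t : R) :
  (forall n, Cmod (f n) * r ^ n <= M) -> Rabs t < r ->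
  Cis_series (fun n => f n * RtoC (t ^ n))%C (Cpseries f t).
Proof.
intros Hf Ht. apply Cis_series_pair.
- eapply is_series_ext; [|apply (proj1 (is_pseries_R (fun n => Re (f n)) t _)),
    PSeries_correct, CV_radius_inside, (CV_radius_component Re f r M t re_le_Cmod Hf Ht)].
  intros n. cbn beta. now rewrite Re_mult_R.
- eapply is_series_ext; [|apply (proj1 (is_pseries_R (fun n => Im (f n)) t _)),
    PSeries_correct, CV_radius_inside, (CV_radius_component Im f r M t im_le_Cmod Hf Ht)].
  intros n. cbn beta. now rewrite Im_mult_R.
Qed.

Lemma Cpseries_derive (f : nat -> C) (r M t : R) :
  (forall n, Cmod (f n) * r ^ n <= M) -> Rabs t < r ->
  exists d : C, is_Cderive (Cpseries f) t d /\
   Cis_series (fun n => RtoC (INR (S n)) * f (S n) * RtoC (t ^ n))%C d.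
Proof.
intros Hf Ht.
pose proof (CV_radius_component Re f r M t re_le_Cmod Hf Ht) as R1.
pose proof (CV_radius_component Im f r M t im_le_Cmod Hf Ht) as R2.
eexists (_, _). split; [split|apply Cis_series_pair].
- apply (is_derive_PSeries _ _ R1).
- apply (is_derive_PSeries _ _ R2).
- eapply is_series_ext; [|apply (proj1 (is_pseries_R (PS_derive (fun n => Re (f n))) t _)),
    PSeries_correct, ex_pseries_derive, R1].
  intros n. unfold PS_derive. rewrite Re_mult_R. f_equal.
  now rewrite Cmult_comm, Re_mult_R, Rmult_comm.
- eapply is_series_ext; [|apply (proj1 (is_pseries_R (PS_derive (fun n => Im (f n))) t _)),
    PSeries_correct, ex_pseries_derive, R2].
  intros n. unfold PS_derive. rewrite Im_mult_R. f_equal.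
  now rewrite Cmult_comm, Im_mult_R, Rmult_comm.
Qed.

(** Let [F t] be the sum of the series at [t * rho], for [t] in the real interval
    from [0] to [1].  The recurrence of the coefficients is the differential
    equation [(1 - t rho) F' = c rho F], so the product of [F] and
    [(1 - t rho) ^ c] has derivative [0] and keeps its value [1] at [t = 0].  The
    segment stays in the half-plane of positive real part, where the principal
    logarithm is smooth. *)
Lemma binomial_series (c rho : C) :
  Cmod rho < 1 ->
  exists S : C, Cis_series (fun n => poch_fact c n * rho ^ n)%C S /\
    (Cpower (1 - rho) c * S)%C = RtoC 1.
Proof.
intros Hrho. pose proof (Cmod_ge_0 rho) as Hrho0.
set (f := fun n => (poch_fact c n * rho ^ n)%C).
(* A radius beyond [1] at which the coefficients stay bounded, so that the real
   power series can be differentiated up to and including [t = 1]. *)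
set (r := 2 / (1 + Cmod rho)).
assert (Hr : 1 < r).
{ unfold r. apply Rmult_lt_reg_r with (1 + Cmod rho); [lra|].
  unfold Rdiv. rewrite Rmult_assoc, Rinv_l; lra. }
assert (Hs : 0 <= Cmod rho * r < 1).
{ split; [apply Rmult_le_pos; lra|].
  unfold r. apply Rmult_lt_reg_r with (1 + Cmod rho); [lra|].
  replace (Cmod rho * (2 / (1 + Cmod rho)) * (1 + Cmod rho)) with (2 * Cmod rho) by (field; lra).
  lra. }
destruct (INR_unbounded (Cmod c)) as [N HN].
set (M := (/ (1 - Cmod rho * r)) ^ N).
assert (Hf : forall n, Cmod (f n) * r ^ n <= M).
{ intros n. unfold f. rewrite Cmod_mult, Cmod_pow, Rmult_assoc, <- Rpow_mult_distr.
  apply poch_fact_geom_bound; [exact Hs|lra]. }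
assert (Hrec : forall n, (RtoC (INR (S n)) * f (S n))%C = ((c + INR n) * rho * f n)%C).
{ intros n. unfold f. rewrite Cpow_S.
  transitivity ((RtoC (INR (S n)) * poch_fact c (S n)) * (rho * rho ^ n))%C; [ring|].
  rewrite poch_fact_S. ring. }
exists (Cpseries f 1). split.
{ assert (H1 : Rabs 1 < r) by (rewrite Rabs_R1; exact Hr).
  pose proof (Cpseries_sum f r M 1 Hf H1) as H.
  eapply is_series_ext; [|exact H].
  intros n. cbn beta. rewrite pow1. apply Cmult_1_r. }
assert (Hpos : forall t, 0 <= t <= 1 -> 0 < Re (1 - t * rho)).
{ intros t Ht. apply Re_1_minus_pos. rewrite Cmod_mult, Cmod_R, Rabs_pos_eq by lra. nra. }
set (G := fun t : R => (Cexp (c * Clog_right (1 - t * rho)) * Cpseries f t)%C).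
assert (HG : G 0 = G 1).
{ apply is_Cderive_0_const; [|lra]. intros t Ht.
  assert (Htr : Rabs t < r) by (rewrite Rabs_pos_eq; lra).
  destruct (Cpseries_derive f r M t Hf Htr) as [d [Hd Hsd]].
  pose proof (Cpseries_sum f r M t Hf Htr) as Hsum.
  (* [Hrec] summed over [n]; the series of the [n * f n * t ^ n] is [t] times the
     series of the derivative, shifted by one index. *)
  assert (Hode : d = (c * rho * Cpseries f t + rho * (RtoC t * d))%C).
  { apply (Cis_series_inj _ _ _ Hsd).
    eapply Cis_series_ext; [|apply Cis_series_plus; apply Cis_series_scal].
    2: exact Hsum.
    2:{ apply (Cis_series_shift (fun n => RtoC (INR n) * f n * RtoC (t ^ n))%C).
        - simpl. ring.
        - eapply Cis_series_ext; [|apply (Cis_series_scal (RtoC t)); exact Hsd].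
          intros n. cbn beta. simpl pow. rewrite RtoC_mult. ring. }
    intros n. cbn beta. rewrite Hrec. ring. }
  assert (Hw : (1 - t * rho)%C <> RtoC 0).
  { intros E. specialize (Hpos t Ht). rewrite E in Hpos. simpl in Hpos. lra. }
  pose proof (is_Cderive_mult _ _ _ _ _
     (is_Cderive_exp _ _ _ (is_Cderive_mult _ _ _ _ _ (is_Cderive_const c t)
        (is_Cderive_Clog_right rho t (Hpos t Ht)))) Hd) as HD.
  assert (Hz : forall E : C,
    ((0 * Clog_right (1 - t * rho) + c * (- rho / (1 - t * rho))) * E * Cpseries f t
     + E * d)%C = RtoC 0).
  { intros E.
    replace d with (c * rho * Cpseries f t / (1 - t * rho))%C; [field; exact Hw|].
    replace (c * rho * Cpseries f t)%C with (d - rho * (RtoC t * d))%C;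
      [field; exact Hw|].
    rewrite Hode at 1. ring. }
  unfold G. match type of HD with is_Cderive _ _ ?l => replace (RtoC 0) with l; [exact HD|] end.
  apply Hz. }
unfold Cpower. rewrite Clog_Clog_right by (apply Re_1_minus_pos, Hrho).
transitivity (G 1); [unfold G; now rewrite Cmult_1_l|]. rewrite <- HG.
unfold G. rewrite Cmult_0_l.
assert (E1 : Clog_right (1 - 0) = RtoC 0).
{ unfold Clog_right, RtoC, Cminus, Cplus, Copp. cbn [Re Im fst snd].
  f_equal.
  - replace ((1 + -0) * (1 + -0) + (0 + -0) * (0 + -0)) with 1 by ring. rewrite ln_1. lra.
  - replace ((0 + - 0) / (1 + -0)) with 0 by field. apply atan_0. }
rewrite E1, Cmult_0_r, Cexp_0, Cmult_1_l.
unfold Cpseries. rewrite !PSeries_0. unfold f. rewrite poch_fact_O. simpl.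
unfold RtoC. f_equal; ring.
Qed.

(** * Hypergeometric functions and Laguerre polynomials *)

Lemma Hyp2F1_series (a b c z : C) :
  Cmod z < 1 -> (forall n, (c + INR n)%C <> RtoC 0) ->
  Cis_series (fun n => Cpoch a n * Cpoch b n / Cpoch c n * (z ^ n / INR (fact n)))%C
    (Hyp2F1 a b c z).
Proof.
intros Hz Hc.
destruct (Cpoch_ratio_power_bound a c z Hz Hc) as [K [q [HK [Hq Hb]]]].
destruct (INR_unbounded (Cmod b)) as [N HN].
apply (Cis_series_dominated _ (fun n => K * (/ (1 - q)) ^ N * q ^ n)).
- intros n.
  replace (Cpoch a n * Cpoch b n / Cpoch c n * (z ^ n / INR (fact n)))%C
    with ((z ^ n * (Cpoch a n / Cpoch c n)) * poch_fact b n)%C by (unfold poch_fact, Cdiv; ring).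
  rewrite Cmod_mult.
  apply Rle_trans with (K * (q * q) ^ n * Cmod (poch_fact b n)).
  + apply Rmult_le_compat_r; [apply Cmod_ge_0|apply Hb].
  + rewrite Rpow_mult_distr.
    replace (K * (q ^ n * q ^ n) * Cmod (poch_fact b n))
      with (K * q ^ n * (Cmod (poch_fact b n) * q ^ n)) by ring.
    replace (K * (/ (1 - q)) ^ N * q ^ n) with (K * q ^ n * (/ (1 - q)) ^ N) by ring.
    apply Rmult_le_compat_l; [apply Rmult_le_pos; [exact HK|apply pow_le; lra]|].
    apply poch_fact_geom_bound; lra.
- apply (ex_series_scal (V := R_NormedModule)). apply ex_series_geom.
  rewrite Rabs_pos_eq; lra.
Qed.

Lemma Cpoch_opp_INR (k m : nat) : (m <= k)%nat ->
  (Cpoch (- INR k) m * INR (fact (k - m)))%C = ((- (1)) ^ m * INR (fact k))%C.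
Proof.
intros Hm. induction m as [|m IH].
- rewrite Nat.sub_0_r. simpl. ring.
- rewrite Cpow_S, <- Cmult_assoc, <- IH by lia.
  replace (k - m)%nat with (S (k - S m)) by lia.
  rewrite INR_fact_S_C. cbn [Cpoch].
  rewrite minus_INR by lia. rewrite S_INR, RtoC_minus, RtoC_plus. ring.
Qed.

Lemma Cpoch_opp_INR_0 (k m : nat) : (k < m)%nat -> Cpoch (- INR k)%C m = RtoC 0.
Proof.
intros Hm. replace m with (S k + (m - S k))%nat by lia.
rewrite Cpoch_add. cbn [Cpoch]. ring.
Qed.

(** The factor [Cpoch (- k) m] cuts the confluent series off after [m = k] and
    contributes [(-1) ^ m * k! / (k - m)!]; the rest is [Cpoch_add] for
    [Cpoch (beta + 1) k]. *)
Lemma Laguerre_sum (k : nat) (beta : C) (x : C) :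
  (forall n, (beta + 1 + INR n)%C <> RtoC 0) ->
  Laguerre k beta x =
  Csum (fun m => (- x) ^ m / INR (fact m) * poch_fact (beta + 1 + INR m) (k - m))%C k.
Proof.
intros Hb. unfold Laguerre, KummerM.
rewrite (CSeries_unique _ (Csum
  (fun m => Cpoch (- INR k) m / Cpoch (beta + 1) m * (x ^ m / INR (fact m)))%C k)).
2:{ apply Cis_series_finite. intros n Hn. rewrite (Cpoch_opp_INR_0 k n Hn).
    unfold Cdiv. now rewrite !Cmult_0_l. }
rewrite <- Csum_scal. apply Csum_ext. intros m Hm.
pose proof (Cpoch_neq_0 _ m Hb) as Hp.
pose proof (Cpoch_opp_INR k m Hm) as E.
replace (- x)%C with (- (1) * x)%C by ring. rewrite Cpow_mult_l.
unfold poch_fact.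
assert (Ek : Cpoch (beta + 1) k = (Cpoch (beta + 1) m * Cpoch (beta + 1 + INR m) (k - m))%C).
{ rewrite <- Cpoch_add. f_equal. lia. }
rewrite Ek.
pose proof (INR_fact_neq_0_C k) as F1. pose proof (INR_fact_neq_0_C m) as F2.
pose proof (INR_fact_neq_0_C (k - m)) as F3.
replace (Cpoch (- INR k) m) with ((- (1)) ^ m * INR (fact k) / INR (fact (k - m)))%C.
- field. repeat split; assumption.
- rewrite <- E. field. exact F3.
Qed.

(** * The triple series *)

(** The general term of the series once the Gauss functions (index [i]) and the
    Laguerre polynomials (power [m] of [x], with [k = m + j]) are written out;
    [a] and [b] stand for [alpha + 1] and [beta + 1].  The quotient of Pochhammer
    symbols of the coefficient [k] and that of the [i]-th term of the Gauss
    function merge into one, by [Cpoch_add]. *)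
Definition expansion_term (lambda a : C) (b : C) (rho x : C) (m j i : nat) : C :=
  ((- x) ^ m / INR (fact m) * (rho ^ (m + j + i) * (Cpoch lambda (m + j + i) / Cpoch a (m + j + i)))
   * poch_fact (b + INR m) j * poch_fact (a - b) i)%C.

(** The exponent [m + j + i] of [q * q] leaves one power of [q] for each
    [poch_fact] and one for summability in [j] and in [i].  The bound
    [(1 - q) ^ (-N-m)] on [poch_fact (b + m) j] grows with [m], but only
    geometrically, and [m!] absorbs it. *)
Lemma expansion_term_bound (lambda a b rho x : C) :
  Cmod rho < 1 -> (forall n, (a + INR n)%C <> RtoC 0) ->
  exists K Y q, 0 <= K /\ 0 <= Y /\ 0 < q < 1 /\ forall m j i,
  Cmod (expansion_term lambda a b rho x m j i) <= K * (Y ^ m / INR (fact m)) * q ^ j * q ^ i.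
Proof.
intros Hrho Ha.
destruct (Cpoch_ratio_power_bound lambda a rho Hrho Ha) as [K [q [HK [Hq Hb]]]].
destruct (INR_unbounded (Cmod b)) as [N HN].
destruct (INR_unbounded (Cmod (a - b))) as [N' HN'].
set (p := / (1 - q)).
assert (Hp : 0 < p) by (apply Rinv_0_lt_compat; lra).
assert (Hpn : forall n, 0 <= p ^ n) by (intros; apply pow_le; lra).
assert (Hqn : forall n, 0 <= q ^ n) by (intros; apply pow_le; lra).
exists (K * p ^ N * p ^ N'), (Cmod x * (q * q) * p), q.
split; [|split; [|split; [exact Hq|]]].
{ repeat apply Rmult_le_pos; auto. }
{ repeat apply Rmult_le_pos; try lra. apply Cmod_ge_0. }
intros m j i. unfold expansion_term.
assert (Hj : Cmod (poch_fact (b + INR m) j) * q ^ j <= p ^ (N + m)).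
{ apply poch_fact_geom_bound; [lra|]. rewrite plus_INR.
  eapply Rle_trans; [apply Cmod_triangle|]. rewrite Cmod_INR. lra. }
assert (Hi : Cmod (poch_fact (a - b) i) * q ^ i <= p ^ N').
{ apply poch_fact_geom_bound; lra. }
specialize (Hb (m + j + i)%nat).
rewrite !(Cmod_mult _ (poch_fact _ _)), Cmod_mult.
rewrite Cmod_div by apply INR_fact_neq_0_C. rewrite Cmod_INR, Cmod_pow, Cmod_opp.
pose proof (INR_fact_lt_0 m) as Hf.
assert (Hx : 0 <= Cmod x ^ m / INR (fact m)).
{ apply Rmult_le_pos; [apply pow_le, Cmod_ge_0|]. left. now apply Rinv_0_lt_compat. }
set (X := Cmod x ^ m / INR (fact m)) in *.
apply Rle_trans with (X * (K * (q * q) ^ (m + j + i)) * Cmod (poch_fact (b + INR m) j)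
  * Cmod (poch_fact (a - b) i)).
{ repeat apply Rmult_le_compat_r; try apply Cmod_ge_0.
  apply Rmult_le_compat_l; assumption. }
replace (X * (K * (q * q) ^ (m + j + i)) * Cmod (poch_fact (b + INR m) j)
  * Cmod (poch_fact (a - b) i))
 with ((X * K * (q * q) ^ m * q ^ j * q ^ i) *
   ((Cmod (poch_fact (b + INR m) j) * q ^ j) * (Cmod (poch_fact (a - b) i) * q ^ i)))
 by (rewrite !pow_add, !(Rpow_mult_distr q q); ring).
replace (K * p ^ N * p ^ N' * ((Cmod x * (q * q) * p) ^ m / INR (fact m)) * q ^ j * q ^ i)
 with ((X * K * (q * q) ^ m * q ^ j * q ^ i) * (p ^ (N + m) * p ^ N'))
 by (rewrite pow_add, !Rpow_mult_distr; unfold X, Rdiv; ring).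
apply Rmult_le_compat_l.
- assert (0 <= (q * q) ^ m) by (apply pow_le; nra).
  clearbody X. repeat apply Rmult_le_pos; auto.
- apply Rmult_le_compat; auto; apply Rmult_le_pos; auto; apply Cmod_ge_0.
Qed.

Lemma expansion_regroup (lambda a b rho x : C) :
  Cmod rho < 1 -> (forall n, (a + INR n)%C <> RtoC 0) ->
  let g := expansion_term lambda a b rho x in
  exists S : C,
    Cis_series (fun k => CSeries (fun i => Csum (fun m => g m (k - m)%nat i) k)) S /\
    Cis_series (fun m => CSeries (fun n => Csum (fun i => g m (n - i)%nat i) n)) S.
Proof.
intros Hrho Ha g.
destruct (expansion_term_bound lambda a b rho x Hrho Ha) as [K [Y [q [HK [HY [Hq Hb]]]]]].
assert (Hgeom : ex_series (fun n => q ^ n)).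
{ apply ex_series_geom. rewrite Rabs_pos_eq; lra. }
assert (Hgeom0 : forall n, 0 <= q ^ n) by (intros n; apply pow_le; lra).
apply (triple_series_regroup g (fun m => K * (Y ^ m / INR (fact m)))
   (fun j => q ^ j) (fun i => q ^ i)); auto.
- intros m. pose proof (INR_fact_lt_0 m). apply Rmult_le_pos; [exact HK|].
  apply Rmult_le_pos; [now apply pow_le|]. left. now apply Rinv_0_lt_compat.
- apply (ex_series_scal (V := R_NormedModule)). exists (exp Y).
  eapply is_series_ext; [|apply (proj1 (is_pseries_R (fun n => / INR (fact n)) Y _)), is_exp_Reals].
  intros n. apply Rmult_comm.
Qed.

Lemma expansion_row_sum (lambda a b rho x : C) (k i : nat) :
  (forall n, (a + INR n)%C <> RtoC 0) -> (forall n, (b + INR n)%C <> RtoC 0) ->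
  Csum (fun m => expansion_term lambda a b rho x m (k - m)%nat i) k =
  (Cpoch lambda k / Cpoch a k * rho ^ k * Laguerre k (b - 1) x *
   (Cpoch (lambda + INR k) i * Cpoch (a - b) i / Cpoch (a + INR k) i * (rho ^ i / INR (fact i))))%C.
Proof.
intros Ha Hb. rewrite Laguerre_sum.
2:{ intros n. replace (b - 1 + 1)%C with b by ring. apply Hb. }
replace (b - 1 + 1)%C with b by ring.
set (u := (Cpoch (lambda + INR k) i * Cpoch (a - b) i / Cpoch (a + INR k) i
    * (rho ^ i / INR (fact i)))%C).
transitivity ((Cpoch lambda k / Cpoch a k * rho ^ k * u) *
   Csum (fun m => (- x) ^ m / INR (fact m) * poch_fact (b + INR m) (k - m)) k)%C; [|ring].
rewrite <- Csum_scal. apply Csum_ext. intros m Hm. unfold expansion_term, u.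
replace (m + (k - m) + i)%nat with (k + i)%nat by lia.
rewrite !Cpoch_add, Cpow_add_r.
unfold poch_fact at 2. field.
repeat split; try apply INR_fact_neq_0_C; apply Cpoch_neq_0; auto.
intros n. rewrite <- Cplus_assoc, <- RtoC_plus, <- plus_INR. apply Ha.
Qed.

(** The sum over [i] is the Vandermonde convolution of [a - b] and [b + m]; its
    value [poch_fact (a + m) n] cancels the denominator, which leaves a term of a
    binomial series. *)
Lemma expansion_column_sum (lambda a b rho x : C) (m n : nat) :
  (forall n, (a + INR n)%C <> RtoC 0) ->
  Csum (fun i => expansion_term lambda a b rho x m (n - i)%nat i) n =
  (Cpoch lambda m / Cpoch a m * ((- x * rho) ^ m / INR (fact m)) *
   (poch_fact (lambda + INR m) n * rho ^ n))%C.
Proof.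
intros Ha.
transitivity ((- x) ^ m / INR (fact m) *
  (rho ^ (m + n) * (Cpoch lambda (m + n) / Cpoch a (m + n))) * poch_fact (a + INR m) n)%C.
- replace (a + INR m)%C with ((a - b) + (b + INR m))%C by ring.
  rewrite <- poch_fact_vandermonde, <- Csum_scal. apply Csum_ext. intros i Hi.
  unfold expansion_term. replace (m + (n - i) + i)%nat with (m + n)%nat by lia. ring.
- rewrite !Cpoch_add, Cpow_add_r, Cpow_mult_l. unfold poch_fact. field.
  repeat split; try apply INR_fact_neq_0_C; apply Cpoch_neq_0; auto.
  intros k. rewrite <- Cplus_assoc, <- RtoC_plus, <- plus_INR. apply Ha.
Qed.

(** Along the rows the triple series is the series of the statement.  Along the
    columns it consists of binomial series of exponent [lambda + m], with sums
    [(1 - rho) ^ (-lambda - m)]; multiplied by [(1 - rho) ^ lambda], they give the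
    terms of the Kummer series. *)
Lemma Kummer_expansion (lambda a b rho x : C) :
  Cmod rho < 1 -> (forall n, (a + INR n)%C <> RtoC 0) -> (forall n, (b + INR n)%C <> RtoC 0) ->
  exists S : C,
  Cis_series (fun k => Cpoch lambda k / Cpoch a k
     * Hyp2F1 (lambda + INR k) (a - b) (a + INR k) rho
     * rho ^ k * Laguerre k (b - 1) x)%C S /\
  KummerM lambda a (x * rho / (rho - 1)) = (Cpower (1 - rho) lambda * S)%C.
Proof.
intros Hrho Ha Hb.
destruct (expansion_regroup lambda a b rho x Hrho Ha) as [S [Hrow Hcol]].
assert (H1 : (1 - rho)%C <> RtoC 0).
{ intros E. pose proof (Re_1_minus_pos rho Hrho) as Hp. rewrite E in Hp. simpl in Hp. lra. }
exists S. split.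
- eapply Cis_series_ext; [|exact Hrow]. intros k. cbn beta. apply CSeries_unique.
  eapply Cis_series_ext; [intros i; symmetry; now apply expansion_row_sum|].
  match goal with |- Cis_series _ ?l => replace l with
    (Cpoch lambda k / Cpoch a k * rho ^ k * Laguerre k (b - 1) x
     * Hyp2F1 (lambda + INR k) (a - b) (a + INR k) rho)%C by ring end.
  apply Cis_series_scal, Hyp2F1_series; [exact Hrho|].
  intros n. rewrite <- Cplus_assoc, <- RtoC_plus, <- plus_INR. apply Ha.
- unfold KummerM. apply CSeries_unique.
  eapply Cis_series_ext; [|apply (Cis_series_scal (Cpower (1 - rho) lambda)), Hcol].
  intros m. cbn beta.
  destruct (binomial_series (lambda + INR m) rho Hrho) as [B [HB EB]].
  rewrite Cpower_plus_INR in EB by exact H1.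
  rewrite (CSeries_unique _ (Cpoch lambda m / Cpoch a m * ((- x * rho) ^ m / INR (fact m)) * B)).
  + assert (H2 : (rho - 1)%C <> RtoC 0).
    { intros E. apply H1. replace (1 - rho)%C with (- (rho - 1))%C by ring. rewrite E. ring. }
    replace (x * rho / (rho - 1))%C with (- x * rho * / (1 - rho))%C by (field; split; assumption).
    rewrite (Cpow_mult_l _ (/ (1 - rho))), Cpow_inv by exact H1.
    transitivity (Cpoch lambda m / Cpoch a m * ((- x * rho) ^ m / INR (fact m))
      * ((Cpower (1 - rho) lambda * (1 - rho) ^ m * B) * / (1 - rho) ^ m))%C.
    * field. repeat split; [now apply Cpow_nz|apply INR_fact_neq_0_C|now apply Cpoch_neq_0].
    * rewrite EB. unfold Cdiv. ring.
  + eapply Cis_series_ext; [intros n; symmetry; now apply expansion_column_sum|].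
    apply Cis_series_scal, HB.
Qed.

Theorem theorem10 (lambda alpha : C) (beta : R) (rho : C) (x : R)
  (Halpha : forall n : nat, alpha <> RtoC (- INR (S n)))
  (Hbeta : -1 < beta)
  (Hrho : Cmod rho < 1)
  (Hx : 0 < x) :
  let term (k : nat) : C :=
    (Cpoch lambda k / Cpoch (alpha + 1) k
     * Hyp2F1 (lambda + INR k) (alpha - beta) (alpha + 1 + INR k) rho
     * rho ^ k * Laguerre k beta x)%C in
  ex_series (V := C_NormedModule) term /\
  KummerM lambda (alpha + 1) (x * rho / (rho - 1))
  = (Cpower (1 - rho) lambda * CSeries term)%C.
Proof.
intros term.
destruct (Kummer_expansion lambda (alpha + 1) (beta + 1) rho x Hrho) as [S [HS HM]].
- intros n E. apply (Halpha n). rewrite S_INR, RtoC_opp, RtoC_plus.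
  replace alpha with (alpha + 1 + INR n - (INR n + 1))%C by ring. rewrite E. ring.
- intros n. rewrite <- !RtoC_plus. apply RtoC_neq_0. pose proof (pos_INR n). lra.
- replace (alpha + 1 - (beta + 1))%C with (alpha - beta)%C in HS by ring.
  replace (beta + 1 - 1)%C with (RtoC beta) in HS by ring.
  change (Cis_series term S) in HS. split.
  + now exists S.
  + now rewrite (CSeries_unique term S HS).
Qed.
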